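(* Fix $0<t_1<t_0$. There exists a real-valued measurable function $g$ on $\mathbb{C}$ such that: (1) for every $a\in\mathbb{C}$, $gk_a\in L^2(\mu)$; (2) $H_{t_0}g\in L^\infty(\mathbb{C})$; (3) $H_{t_1}g\notin L^\infty(\mathbb{C})$. In particular, for every $\varepsilon\in(0,1/8)$, boundedness of $g^{(1/8)}$ does not imply boundedness of $g^{(1/8-\varepsilon)}$, even under the hypothesis that $gk_a\in L^2(\mu)$ for every $a\in\mathbb{C}$.
   Context: $dA$ is planar Lebesgue measure and $d\mu(z)=\pi^{-1}e^{-|z|^2}\,dA(z)$. For $a\in\mathbb{C}$, $k_a(z)=e^{z\overline a-|a|^2/2}$. For $t>0$ the heat operator is $H_tg(x)=g^{(t)}(x)=\frac{1}{4\pi t}\int_{\mathbb{C}}g(y)e^{-|x-y|^2/(4t)}\,dA(y)$. *)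

(* Defs.v *)
From HB Require Import structures.
From mathcomp Require Import all_boot all_order all_algebra.
From mathcomp Require Import all_classical all_reals all_analysis.
From mathcomp Require Import measurable_realfun complex.

Set Implicit Arguments.
Unset Strict Implicit.
Unset Printing Implicit Defensive.

Import Order.TTheory GRing.Theory Num.Theory.
Import numFieldNormedType.Exports.
Import ComplexField.Normc.

Local Open Scope classical_set_scope.
Local Open Scope ring_scope.

Definition toC (R : realType) (p : measurableTypeR R * measurableTypeR R) : R[i] :=
  Complex p.1 p.2.

(* The Borel sigma-algebra of the complex plane, transported from that of
   R * R by the bijection toC. *)
Section complex_measurable.
Variable R : realType.

Definition complex_measurable : set (set R[i]) :=
  [set A | measurable (@toC R @^-1` A)].

Let complex_measurable0 : complex_measurable set0.
Proof. by rewrite /complex_measurable /= preimage_set0. Qed.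

Let complex_measurableC A : complex_measurable A -> complex_measurable (~` A).
Proof.
by move=> mA; rewrite /complex_measurable /= preimage_setC; exact: measurableC.
Qed.

Let complex_measurable_bigcup (F : (set R[i])^nat) :
  (forall i, complex_measurable (F i)) -> complex_measurable (\bigcup_i F i).
Proof.
move=> mF; rewrite /complex_measurable /= preimage_bigcup.
by apply: bigcupT_measurable => i; exact: mF.
Qed.

HB.instance Definition _ := isPointed.Build R[i] 0.
HB.instance Definition _ := isMeasurable.Build default_measure_display R[i]
  complex_measurable0 complex_measurableC complex_measurable_bigcup.

End complex_measurable.

Lemma measurable_toC (R : realType) : measurable_fun setT (@toC R).
Proof. by move=> _ A mA; rewrite setTI. Qed.

Section planar_measures.
Variable R : realType.
Implicit Types A : set R[i].

(* Planar Lebesgue measure. *)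
Definition dA : set R[i] -> \bar R :=
  pushforward (lebesgue_measure \x lebesgue_measure)%E (@toC R).

Let dA0 : dA set0 = 0%E.
Proof. by rewrite /dA /pushforward preimage_set0 measure0. Qed.

Let dA_ge0 A : (0 <= dA A)%E.
Proof. by rewrite /dA /pushforward measure_ge0. Qed.

Let dA_sigma_additive : semi_sigma_additive dA.
Proof.
move=> F mF tF mUF; rewrite /dA /pushforward preimage_bigcup.
apply: measure_semi_sigma_additive => //.
apply/trivIsetP => /= i j _ _ ij; rewrite -preimage_setI.
by move/trivIsetP : tF => /(_ _ _ _ _ ij) ->//; rewrite preimage_set0.
Qed.

HB.instance Definition _ := isMeasure.Build _ _ _ dA
  dA0 dA_ge0 dA_sigma_additive.

Definition gauss_density (z : R[i]) : R := pi^-1 * expR (- normc z ^+ 2).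

Lemma gauss_density_ge0 z : 0 <= gauss_density z.
Proof. by rewrite mulr_ge0 ?invr_ge0 ?pi_ge0 ?expR_ge0. Qed.

Lemma measurable_gauss_density : measurable_fun setT gauss_density.
Proof.
apply: measurable_funM => //; apply: measurableT_comp => //.
apply: measurableT_comp => //.
move=> _ B mB; rewrite setTI.
suff mh : measurable_fun setT
    (fun p : measurableTypeR R * measurableTypeR R => normc (toC p) ^+ 2).
  by have := mh measurableT B mB; rewrite setTI.
rewrite (_ : (fun _ => _) = (fun p : measurableTypeR R * measurableTypeR R =>
    (p.1 : R) ^+ 2 + (p.2 : R) ^+ 2)).
  by apply: measurable_funD; apply: measurable_funX.
by apply/funext => p; rewrite /= sqr_sqrtr// addr_ge0// sqr_ge0.
Qed.

Definition gauss_measure A : \bar R := (\int[dA]_(z in A) (gauss_density z)%:E)%E.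

Let gauss0 : gauss_measure set0 = 0%E.
Proof. by rewrite /gauss_measure integral_set0. Qed.

Let gauss_ge0 A : (0 <= gauss_measure A)%E.
Proof. by apply: integral_ge0 => z _; rewrite lee_fin gauss_density_ge0. Qed.

Let gauss_sigma_additive : semi_sigma_additive gauss_measure.
Proof.
move=> F mF tF mUF; rewrite /gauss_measure ge0_integral_bigcup//.
- apply: is_cvg_ereal_nneg_natsum_cond => n _ _.
  by apply: integral_ge0 => z _; rewrite lee_fin gauss_density_ge0.
- by apply/measurable_EFinP/measurable_funTS; exact: measurable_gauss_density.
- by move=> z _; rewrite lee_fin gauss_density_ge0.
Qed.

HB.instance Definition _ := isMeasure.Build _ _ _ gauss_measure
  gauss0 gauss_ge0 gauss_sigma_additive.

End planar_measures.
Arguments dA {R}.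
Arguments gauss_measure {R}.

Section heat.
Variable R : realType.
Implicit Types (a x y z : R[i]) (f : R[i] -> R[i]) (g : R[i] -> R).

Definition cexp z : R[i] :=
  Complex (expR (complex.Re z) * cos (complex.Im z)) (expR (complex.Re z) * sin (complex.Im z)).

Definition coherent a z : R[i] :=
  cexp (z * conjc a - real_complex R (normc a ^+ 2 / 2)).

(* Complex-valued square-integrable functions (Lfun only covers real-valued
   ones). *)
Definition L2 f : Prop :=
  measurable_fun setT f /\
  finite_norm (@gauss_measure R) 2%:E (fun z => normc (f z)).

Definition heat_integrand (t : R) g x y : R :=
  g y * expR (- (normc (x - y) ^+ 2 / (4 * t))).

Definition heat (t : R) g x : R :=
  (4 * pi * t)^-1 * \int[dA]_y heat_integrand t g x y.

(* The integral defining heat t g x converges absolutely for every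
   x; without it, the value of heat is a junk value. *)
Definition heat_defined (t : R) g : Prop :=
  forall x, dA.-integrable setT (fun y => (heat_integrand t g x y)%:E).

End heat.

(* Main.v *)
Require Import Defs.
From HB Require Import structures.
From mathcomp Require Import all_boot all_order all_algebra.
From mathcomp Require Import all_classical all_reals all_analysis.
From mathcomp Require Import measurable_realfun complex.
From mathcomp Require Import ess_sup_inf ring lra.

(** Write z = x + iy.  The function that works is the chirp
      g(z) = exp(c (x^2 + y^2)) cos(l x y),
    with c > 0 small.  It is the real part of the exponential of a
    quadratic form which is, after a rotation of the axes by pi/4,
    w x^2 + (conj w) y^2 with w = c + i l/2, and the heat flow sends a Gaussian
    exponent w to w / (1 - 4 t w) = 1 / (1/w - 4 t).  Hence H_t g is again a
    constant times exp(k (x^2 + y^2)) cos(th x y), where k is the real part of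
    1 / (1/w - 4 t), which has the sign of Re (1/w) - 4 t.  Choosing Re (1/w) = 4 t_0,
    that is c^2 + l^2/4 = c / (4 t_0), makes k vanish at t_0, so that H_{t_0} g is
    bounded, and makes k positive at t_1 < t_0, so that H_{t_1} g grows like a
    Gaussian near the real axis.  The number c may be taken as small as one wishes:
    c < 1/(4 t_0) makes the heat integrals converge, and c < 1/2 puts every
    g k_a in L^2 of the Gaussian measure.

    Because the saddle l x y couples the two coordinates bilinearly, the computation
    of H_t g needs no complex Gaussian: integrating in y at fixed x, and then in x, only
    uses the Fourier transform of a real Gaussian (Rintegral_gausscos).  That formula is
    proved by a differential equation in the frequency, obtained by differentiation
    under the integral sign and integration by parts on the line.  The two successive
    integrations give Rintegral_chirp2 and the closed form heat_saddle_chirp.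

    The same function, with t_0 = 1/8 and t_1 = 1/8 - e, gives the last assertion:
    the bound at t_0 holds at every point, and the failure at t_1 holds on a set of
    positive measure, hence both in the essential and in the pointwise sense. *)

Set Implicit Arguments.
Unset Strict Implicit.
Unset Printing Implicit Defensive.

Import Order.TTheory GRing.Theory Num.Theory.
Import numFieldNormedType.Exports.

Local Open Scope classical_set_scope.
Local Open Scope ring_scope.

(** * Gaussian integrals on the real line *)

Section gaussian_integrals.
Variable R : realType.
Local Notation mu := (@lebesgue_measure R).

Lemma integral_gauss (p m : R) : 0 < p ->
  (\int[mu]_y (expR (- (p * (y - m) ^+ 2)))%:E = (Num.sqrt (pi / p))%:E)%E.
Proof.
move=> p0.
(* The normal density with variance 1/(2p) is proportional to the integrand. *)
pose s := Num.sqrt (2 * p)^-1.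
have s2 : s ^+ 2 = (2 * p)^-1 by rewrite sqr_sqrtr// invr_ge0; lra.
have s0 : s != 0 by rewrite gt_eqF// sqrtr_gt0 invr_gt0; lra.
have pk : normal_peak s = (Num.sqrt (pi / p))^-1.
  rewrite /normal_peak s2; congr (Num.sqrt _)^-1; field; lra.
have k0 := normal_peak_gt0 s0.
have E y : expR (- (p * (y - m) ^+ 2)) =
    (Num.sqrt (pi / p)) * normal_pdf m s y.
  rewrite /normal_pdf (negbTE s0) pk mulVKf; last first.
    by move: k0; rewrite pk invr_gt0 => /gt_eqF ->.
  rewrite /normal_fun s2; congr expR; field; lra.
under eq_integral do rewrite E EFinM.
rewrite integralZl//; last exact: integrable_normal_pdf.
by rewrite integral_normal_pdf mule1.
Qed.

Lemma integrable_gauss (p m : R) : 0 < p ->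
  mu.-integrable setT (fun y => (expR (- (p * (y - m) ^+ 2)))%:E).
Proof.
move=> p0; apply/integrableP; split.
  apply/measurable_EFinP/measurableT_comp => //; apply: measurableT_comp => //.
  apply: measurable_funM => //; apply: measurable_funX.
  exact: measurable_funD.
under eq_integral do rewrite /= ger0_norm ?expR_ge0//.
by rewrite integral_gauss// ltry.
Qed.

(** The fundamental theorem of calculus on the whole line: it is applied on the
    segments [-n, n], and dominated convergence lets n tend to infinity. *)
Lemma Rintegral_derive_eq0 (F f : R -> R) :
  (forall y, is_derive y (1 : R) F (f y)) -> continuous f ->
  mu.-integrable setT (EFin \o f) ->
  F n%:R @[n --> \oo] --> (0 : R) -> F (- n%:R) @[n --> \oo] --> (0 : R) ->
  \int[mu]_y f y = 0.
Proof.
move=> dF cf intf Fy FNy.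
pose A (n : nat) : set R := `[(- n%:R), n%:R]%classic.
have mA n : measurable (A n) by exact: measurable_itv.
have [mf _] := integrableP _ _ _ intf.
have FTC n : (\int[mu]_y ((EFin \o f) \_ (A n)) y = (F n%:R - F (- n%:R))%:E)%E.
  rewrite -integral_mkcond.
  have cF : continuous F.
    move=> x; apply/differentiable_continuous/derivable1_diffP.
    exact: (@ex_derive _ _ _ _ _ _ _ (dF x)).
  case: n => [|n].
    by rewrite /A oppr0 set_itv1 integral_set1 subrr.
  rewrite EFinB; apply: continuous_FTC2.
  - by rewrite ltrNl (lt_trans (_ : _ < 0))// oppr_lt0.
  - exact: continuous_subspaceT.
  - split=> [x _| |]; first exact: (@ex_derive _ _ _ _ _ _ _ (dF x)).
      by apply: cvg_at_right_filter; exact: cF.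
    by apply: cvg_at_left_filter; exact: cF.
  - by move=> x _; rewrite derive1E; apply: derive_val.
have [| | | | |_ _] := @dominated_convergence _ _ _ mu setT measurableT
  (fun n => (EFin \o f) \_ (A n)) (EFin \o f) (abse \o (EFin \o f)).
- move=> n; apply/(measurable_restrictT _ (mA n)).
  exact: measurable_funTS.
- exact: mf.
- apply: aeW => x _; apply: cvg_near_cst; near=> n.
  rewrite patchE mem_set// /A /= in_itv/= -ler_norml.
  by near: n; exact: nbhs_infty_ger.
- exact: integrable_abse.
- apply: aeW => x n _; rewrite patchE; case: ifPn => // _.
  by rewrite abse0 abse_ge0.
under eq_fun do rewrite FTC.
move=> DC.
have D0 : (F n%:R - F (- n%:R))%:E @[n --> \oo] --> (0 : R)%:E.
  by apply: cvg_EFin; [exact: nearW|rewrite -(subrr 0); exact: cvgB].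
by rewrite /Rintegral (cvg_unique _ DC D0).
Unshelve. all: by end_near. Qed.

Lemma cvg_gauss_idn (p m : R) : 0 < p ->
  expR (- (p * (n%:R - m) ^+ 2)) @[n --> \oo] --> (0 : R).
Proof.
move=> p0.
have E n : expR (- (p * (n%:R - m) ^+ 2)) =
    gauss_fun (Num.sqrt p * (n%:R - m)) :> R.
  by rewrite /gauss_fun exprMn sqr_sqrtr// ltW.
under eq_fun do rewrite E.
apply: (cvg_comp _ (fun x => gauss_fun (Num.sqrt p * (x - m))) cvgr_idn).
apply: (cvg_comp (fun x => Num.sqrt p * (x - m)) (@gauss_fun R) _ cvg_gauss_fun).
by apply: gt0_cvgMry; [rewrite sqrtr_gt0|exact: cvg_addrr].
Qed.

Lemma gauss_dominated_integrable (p m K : R) (f : R -> R) : 0 < p ->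
  measurable_fun setT f ->
  (forall y, `|f y| <= K * expR (- (p * (y - m) ^+ 2))) ->
  mu.-integrable setT (EFin \o f).
Proof.
move=> p0 mf fK.
have iK : mu.-integrable setT
    (fun y => (K%:E * (expR (- (p * (y - m) ^+ 2)))%:E)%E).
  by apply: integrableZl => //; exact: integrable_gauss.
apply: le_integrable iK => //; first exact/measurable_EFinP.
move=> y _ /=; rewrite lee_fin (le_trans (fK y))//; exact: ler_norm.
Qed.

(** Half of the Gaussian decay absorbs the linear factor. *)
Lemma norm_mul_gauss_le (p z : R) : 0 < p ->
  `|z| * expR (- (p * z ^+ 2)) <= (1 + 2 / p) * expR (- (p / 2 * z ^+ 2)).
Proof.
move=> p0; set w := p / 2 * z ^+ 2.
have -> : - (p * z ^+ 2) = - w - w by rewrite /w; field.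
rewrite expRD mulrA ler_pM2r ?expR_gt0//.
rewrite expRN ler_pdivrMr ?expR_gt0//.
have w0 : 0 <= w by rewrite /w mulr_ge0 ?sqr_ge0//; lra.
have q0 : 0 <= 2 / p by rewrite divr_ge0 ?ltW.
have zw : `|z| ^+ 2 = 2 / p * w by rewrite real_normK ?num_real// /w; field; lra.
have z1 : `|z| <= 1 + `|z| ^+ 2 by have := sqr_ge0 (`|z| - 1); nra.
have e1 := expR_ge1Dx w.
rewrite (le_trans z1)// zw.
apply: (@le_trans _ _ ((1 + 2 / p) * (1 + w))); first nra.
by rewrite ler_wpM2l// addr_ge0.
Qed.

(** A modulated Gaussian centred at m; the variable y comes last, so that the
    frequency q is the parameter with respect to which integrals are
    differentiated. *)
Definition gausscos (p m psi q y : R) :=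
  expR (- (p * (y - m) ^+ 2)) * cos (q * (y - m) + psi).

Lemma measurable_gausscos p m psi q : measurable_fun setT (gausscos p m psi q).
Proof.
apply: continuous_measurable_fun => y.
apply/differentiable_continuous/derivable1_diffP.
exact: ex_derive.
Qed.

Lemma norm_cos_le1 (x : R) : `|cos x| <= 1.
Proof. by rewrite ler_norml cos_geN1 cos_le1. Qed.

Lemma norm_sin_le1 (x : R) : `|sin x| <= 1.
Proof. by rewrite ler_norml sin_geN1 sin_le1. Qed.

Lemma integrable_gausscos p m psi q : 0 < p ->
  mu.-integrable setT (EFin \o gausscos p m psi q).
Proof.
move=> p0; apply: (@gauss_dominated_integrable p m 1) => // [|y].
  exact: measurable_gausscos.
rewrite mul1r /gausscos normrM (ger0_norm (expR_ge0 _)).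
by rewrite ler_piMr ?expR_ge0// norm_cos_le1.
Qed.

(** The left-hand side is the integral of the derivative of gausscos with respect to
    the frequency.  The integrand h satisfies 2 p h + q gausscos = F', where
    F y = exp(- p (y - m)^2) sin(q (y - m) + psi) vanishes at infinity. *)
Lemma Rintegral_gausscos_by_parts p m psi q : 0 < p ->
  \int[mu]_y (- ((y - m) * expR (- (p * (y - m) ^+ 2)) *
                 sin (q * (y - m) + psi))) =
  - (q / (2 * p)) * \int[mu]_y gausscos p m psi q y.
Proof.
move=> p0.
set h := fun y : R => _.
have ih : mu.-integrable setT (EFin \o h).
  have p20 : 0 < p / 2 by lra.
  apply: (@gauss_dominated_integrable (p / 2) m (1 + 2 / p)) => // [|y].
    apply: continuous_measurable_fun => y.
    apply/differentiable_continuous/derivable1_diffP.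
    exact: ex_derive.
  rewrite /h normrN normrM (le_trans _ (norm_mul_gauss_le (y - m) p0))//.
  rewrite normrM (ger0_norm (expR_ge0 _)) ler_piMr ?norm_sin_le1//.
have ig := @integrable_gausscos p m psi q p0.
have p2 : 2 * p != 0 by lra.
pose f y := 2 * p * h y + q * gausscos p m psi q y.
have i1 : mu.-integrable setT (EFin \o (fun y => 2 * p * h y)).
  exact: (@integrableZl _ _ _ mu _ measurableT (2 * p) (EFin \o h) ih).
have i2 : mu.-integrable setT (EFin \o (fun y => q * gausscos p m psi q y)).
  exact: (@integrableZl _ _ _ mu _ measurableT q _ ig).
have f0 : \int[mu]_y f y = 0.
  apply: (@Rintegral_derive_eq0
    (fun y => expR (- (p * (y - m) ^+ 2)) * sin (q * (y - m) + psi))).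
  - move=> y; apply: is_derive_eq.
    rewrite /f /h /gausscos /GRing.scale/=; ring.
  - move=> y; apply/differentiable_continuous/derivable1_diffP.
    rewrite /f /h /gausscos; exact: ex_derive.
  - rewrite (_ : EFin \o f = (EFin \o (fun y => (2 * p * h y)%R)) \+
        (EFin \o (fun y => (q * gausscos p m psi q y)%R)))%E.
      exact: integrableD.
    by apply/funext => y; rewrite /= -EFinD.
  - apply: norm_cvg0; apply: (squeeze_cvgr _ (cvg_cst 0) (cvg_gauss_idn m p0)).
    near=> n; rewrite normr_ge0/= normrM (ger0_norm (expR_ge0 _)).
    by rewrite ler_piMr ?expR_ge0// norm_sin_le1.
  - apply: norm_cvg0.
    apply: (squeeze_cvgr _ (cvg_cst 0) (cvg_gauss_idn (- m) p0)).
    near=> n; rewrite normr_ge0/= normrM (ger0_norm (expR_ge0 _)).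
    rewrite (_ : (- n%:R - m) ^+ 2 = (n%:R - - m) ^+ 2); last by ring.
    by rewrite ler_piMr ?expR_ge0// norm_sin_le1.
move: f0; rewrite /f RintegralD// !RintegralZl// => /eqP.
rewrite addr_eq0 => /eqP hE.
apply: (mulfI p2); rewrite hE; field; lra.
Unshelve. all: by end_near. Qed.

Lemma is_derive_Rintegral_gausscos p m psi q : 0 < p ->
  is_derive q (1 : R) (fun q => \int[mu]_y gausscos p m psi q y)
    (- (q / (2 * p)) * \int[mu]_y gausscos p m psi q y).
Proof.
move=> p0.
have d1 (x y : R) : is_derive x (1 : R) (fun x => gausscos p m psi x y)
    (- ((y - m) * expR (- (p * (y - m) ^+ 2)) * sin (x * (y - m) + psi))).
  by apply: is_derive_eq; rewrite /GRing.scale/=; ring.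
have p20 : 0 < p / 2 by lra.
pose G y := (1 + 2 / p) * expR (- (p / 2 * (y - m) ^+ 2)).
have G0 y : 0 <= G y.
  by rewrite mulr_ge0 ?expR_ge0// addr_ge0// divr_ge0// ltW.
have iG : mu.-integrable setT (EFin \o G).
  apply: (@integrableZl _ _ _ mu _ measurableT (1 + 2 / p)
    (fun y => (expR (- (p / 2 * (y - m) ^+ 2)))%:E)).
  exact: integrable_gauss.
have dE x y : partial1of2 (gausscos p m psi) x y =
    - ((y - m) * expR (- (p * (y - m) ^+ 2)) * sin (x * (y - m) + psi)).
  by rewrite partial1of2E; exact: derive_val.
have Iq : `]q - 1, q + 1[%classic q by rewrite /= in_itv/=; lra.
have GG x y : `]q - 1, q + 1[%classic x -> [set: R] y ->
    `|partial1of2 (gausscos p m psi) x y| <= G y.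
  move=> _ _; rewrite dE normrN normrM (le_trans _ (norm_mul_gauss_le (y - m) p0))//.
  rewrite normrM (ger0_norm (expR_ge0 _)) ler_piMr ?norm_sin_le1//.
have int x : `]q - 1, q + 1[%classic x ->
    mu.-integrable setT (EFin \o gausscos p m psi x).
  by move=> _; exact: integrable_gausscos.
have der x y : `]q - 1, q + 1[%classic x -> [set: R] y ->
    derivable (fun x => gausscos p m psi x y) x 1.
  by move=> _ _; exact: (@ex_derive _ _ _ _ _ _ _ (d1 x y)).
apply: DeriveDef.
  exact: (derivable_under_integral measurableT Iq int der G0 iG GG).
rewrite -derive1E.
rewrite (differentiation_under_integral measurableT Iq int der G0 iG GG).
under eq_Rintegral do rewrite dE.
exact: Rintegral_gausscos_by_parts.
Qed.

(** Fourier transform of a Gaussian, with a phase: as a function of q the integral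
    solves F' = - (q / 2p) F, so F times exp(q^2 / 4p) is constant. *)
Lemma Rintegral_gausscos p m psi q : 0 < p ->
  \int[mu]_y gausscos p m psi q y =
  Num.sqrt (pi / p) * cos psi * expR (- (q ^+ 2 / (4 * p))).
Proof.
move=> p0.
pose F q := \int[mu]_y gausscos p m psi q y.
have dF x : is_derive x (1 : R) F (- (x / (2 * p)) * F x).
  exact: is_derive_Rintegral_gausscos.
have cst : F q * expR (q ^+ 2 / (4 * p)) = F 0 * expR (0 ^+ 2 / (4 * p)).
  apply: (@is_derive_0_is_cst _ (fun q => F q * expR (q ^+ 2 / (4 * p)))) => x.
  apply: is_derive_eq; rewrite /GRing.scale/=; field; lra.
have F0 : F 0 = Num.sqrt (pi / p) * cos psi.
  rewrite /F /gausscos.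
  under eq_Rintegral do rewrite mul0r add0r.
  rewrite RintegralZr//; last exact: integrable_gauss.
  by rewrite /Rintegral integral_gauss.
rewrite -F0 expRN; apply: (canRL (mulfK _)); first by rewrite gt_eqF ?expR_gt0.
by rewrite cst expr0n/= mul0r expR0 mulr1.
Qed.

End gaussian_integrals.

(** * The planar Gaussian chirp *)

Section planar_gaussian_integrals.
Variable R : realType.
Local Notation mu := (@lebesgue_measure R).
Local Notation R2 := (measurableTypeR R * measurableTypeR R)%type.
Local Notation mu2 := (mu \x mu)%E.

Lemma measurable_gauss2 (p m1 m2 : R) : measurable_fun setT (fun z : R2 =>
  expR (- (p * (z.1 - m1) ^+ 2)) * expR (- (p * (z.2 - m2) ^+ 2)) : R).
Proof.
apply: measurable_funM; apply: measurableT_comp => //;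
  apply: measurableT_comp => //; apply: measurable_funM => //;
  by apply: measurable_funX; exact: measurable_funD.
Qed.

Lemma integrable_gauss2 (p m1 m2 : R) : 0 < p ->
  mu2.-integrable setT (fun z : R2 =>
    (expR (- (p * (z.1 - m1) ^+ 2)) * expR (- (p * (z.2 - m2) ^+ 2)))%:E).
Proof.
move=> p0; apply/integrable12ltyP.
  by apply/measurable_EFinP; exact: measurable_gauss2.
under eq_integral => x _.
  under eq_integral => y _.
    rewrite /= ger0_norm; last by rewrite mulr_ge0 ?expR_ge0.
    rewrite EFinM; over.
  rewrite integralZl//; last exact: integrable_gauss.
  rewrite integral_gauss//; over.
rewrite integralZr//; last exact: integrable_gauss.
by rewrite integral_gauss// -EFinM ltry.
Qed.

Lemma gauss2_dominated_integrable (p m1 m2 K : R) (f : R2 -> R) : 0 < p ->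
  measurable_fun setT f ->
  (forall z, `|f z| <= K * (expR (- (p * (z.1 - m1) ^+ 2)) *
                            expR (- (p * (z.2 - m2) ^+ 2)))) ->
  mu2.-integrable setT (EFin \o f).
Proof.
move=> p0 mf fK.
have iK := @integrableZl _ _ _ mu2 _ measurableT K _ (integrable_gauss2 m1 m2 p0).
apply: le_integrable iK => //; first exact/measurable_EFinP.
move=> y _ /=; rewrite lee_fin (le_trans (fK y))//; exact: ler_norm.
Qed.

(** The normal form, up to a constant factor, of the integrand of the heat
    integral: a Gaussian centred at (m1, m2) modulated by the saddle l x y. *)
Definition chirp2 (p m1 m2 l : R) (z : R2) : R :=
  expR (- (p * (z.1 - m1) ^+ 2)) * (expR (- (p * (z.2 - m2) ^+ 2)) *
  cos (l * (z.1 * z.2))).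

Lemma measurable_chirp2 p m1 m2 l : measurable_fun setT (chirp2 p m1 m2 l).
Proof.
rewrite (_ : chirp2 _ _ _ _ = fun z : R2 => expR (- (p * (z.1 - m1) ^+ 2)) *
  expR (- (p * (z.2 - m2) ^+ 2)) * cos (l * (z.1 * z.2))); last first.
  by apply/funext => z; rewrite /chirp2 mulrA.
apply: measurable_funM; first exact: measurable_gauss2.
apply: measurableT_comp; first exact: continuous_measurable_fun (@continuous_cos R).
by apply: measurable_funM => //; exact: measurable_funM.
Qed.

Lemma integrable_chirp2 p m1 m2 l : 0 < p ->
  mu2.-integrable setT (EFin \o chirp2 p m1 m2 l).
Proof.
move=> p0; apply: (@gauss2_dominated_integrable p m1 m2 1) => // [|z].
  exact: measurable_chirp2.
rewrite mul1r /chirp2 mulrA normrM ger0_norm; last by rewrite mulr_ge0 ?expR_ge0.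
by rewrite ler_piMr ?norm_cos_le1// mulr_ge0 ?expR_ge0.
Qed.

(** Integrating in y at fixed x gives, by Rintegral_gausscos at frequency l x, a
    modulated Gaussian in x whose rate is p' and whose centre is m'. *)
Lemma Rintegral_chirp2 p m1 m2 l p' m' : 0 < p ->
  p' = p + l ^+ 2 / (4 * p) -> p' * m' = p * m1 ->
  \int[mu2]_z chirp2 p m1 m2 l z =
  Num.sqrt (pi / p) * Num.sqrt (pi / p') *
  expR (p' * m' ^+ 2 - p * m1 ^+ 2 - (l * m2) ^+ 2 / (4 * p')) *
  cos (l * m2 * m').
Proof.
move=> p0 p'E m'E.
have p'0 : 0 < p' by rewrite p'E ltr_pwDl// divr_ge0 ?sqr_ge0//; lra.
rewrite /Rintegral -(integral12_prod_meas1 (integrable_chirp2 m1 m2 l p0)).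
set K := Num.sqrt (pi / p) * expR (p' * m' ^+ 2 - p * m1 ^+ 2).
have inner x : fubini_F mu (EFin \o chirp2 p m1 m2 l) x =
    (K%:E * (gausscos p' m' (l * m2 * m') (l * m2) x)%:E)%E.
  rewrite /fubini_F /=.
  have E y : chirp2 p m1 m2 l (x, y) =
      expR (- (p * (x - m1) ^+ 2)) * gausscos p m2 (l * x * m2) (l * x) y.
    rewrite /chirp2 /gausscos/=; congr (_ * (_ * cos _)); ring.
  under eq_integral do rewrite E EFinM.
  rewrite integralZl//; last exact: integrable_gausscos.
  have -> : (\int[mu]_y (gausscos p m2 (l * x * m2) (l * x) y)%:E)%E =
      (\int[mu]_y gausscos p m2 (l * x * m2) (l * x) y)%:E.
    rewrite /Rintegral fineK//.
    by apply: integrable_fin_num => //; exact: integrable_gausscos.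
  rewrite Rintegral_gausscos// -!EFinM; congr EFin.
  rewrite /K /gausscos.
  have -> : l * m2 * (x - m') + l * m2 * m' = l * x * m2 by ring.
  have eE : expR (- (p * (x - m1) ^+ 2)) * expR (- ((l * x) ^+ 2 / (4 * p))) =
      expR (p' * m' ^+ 2 - p * m1 ^+ 2) * expR (- (p' * (x - m') ^+ 2)).
    rewrite -!expRD; congr expR.
    have -> : p' * m' ^+ 2 - p * m1 ^+ 2 + - (p' * (x - m') ^+ 2) =
        - p * m1 ^+ 2 - p' * x ^+ 2 + 2 * (p' * m') * x by ring.
    rewrite m'E p'E; field; lra.
  by rewrite -[RHS]mulrA (mulrA (expR _) (expR _)) -eE; ring.
under eq_integral do rewrite inner.
rewrite integralZl//; last exact: integrable_gausscos.
have -> : (\int[mu]_y (gausscos p' m' (l * m2 * m') (l * m2) y)%:E)%E =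
    (\int[mu]_y gausscos p' m' (l * m2 * m') (l * m2) y)%:E.
  rewrite /Rintegral fineK//.
  by apply: integrable_fin_num => //; exact: integrable_gausscos.
rewrite Rintegral_gausscos//= /K (expRD (_ - _) (- ((l * m2) ^+ 2 / _))); ring.
Qed.

End planar_gaussian_integrals.

(** * Heat flow of the saddle chirp *)

Section complex_plane.
Variable R : realType.
Local Notation mu := (@lebesgue_measure R).
Local Notation mu2 := (mu \x mu)%E.
Local Notation R2 := (measurableTypeR R * measurableTypeR R)%type.
Local Notation normc := ComplexField.Normc.normc.

(** Measurability, integrals and integrability on the complex plane reduce to the
    product R * R, whose Borel structure and measure it carries by definition. *)
Lemma measurable_fun_complex d (T : measurableType d) (f : R[i] -> T) :
  measurable_fun setT (f \o @toC R) -> measurable_fun setT f.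
Proof. by move=> mf _ B mB; have := mf measurableT B mB; rewrite !setTI. Qed.

Lemma measurable_fun_to_complex (f : R[i] -> R[i]) :
  measurable_fun setT (fun z : R2 => complex.Re (f (toC z))) ->
  measurable_fun setT (fun z : R2 => complex.Im (f (toC z))) ->
  measurable_fun setT f.
Proof.
move=> mRe mIm; apply: measurable_fun_complex => _ B mB; rewrite setTI.
have := measurable_fun_pair mRe mIm measurableT mB; rewrite setTI.
congr measurable; apply/funext => z /=.
by rewrite /preimage/= /toC/=; case: (f _).
Qed.

Lemma integral_dA (f : R[i] -> \bar R) : measurable_fun setT f ->
  mu2.-integrable setT (f \o @toC R) ->
  (\int[dA]_z f z = \int[mu2]_z f (toC z))%E.
Proof.
move=> mf intf.
exact: (integral_pushforward (@measurable_toC R) mf (D := setT) intf).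
Qed.

Lemma ge0_integral_dA (f : R[i] -> \bar R) : measurable_fun setT f ->
  (forall z, 0 <= f z)%E ->
  (\int[dA]_z f z = \int[mu2]_z f (toC z))%E.
Proof.
move=> mf f0.
by apply: (ge0_integral_pushforward (@measurable_toC R) _ (D := setT)) => //.
Qed.

Lemma integrable_dA (f : R[i] -> \bar R) : measurable_fun setT f ->
  mu2.-integrable setT (f \o @toC R) -> dA.-integrable setT f.
Proof.
move=> mf intf.
exact: (integrable_pushforward (@measurable_toC R) mf (D := setT) intf).
Qed.

Lemma sqr_normcE (z : R[i]) : normc z ^+ 2 = complex.Re z ^+ 2 + complex.Im z ^+ 2.
Proof. by case: z => a b /=; rewrite sqr_sqrtr// addr_ge0 ?sqr_ge0. Qed.

(** The function of the theorem: exp(c |z|^2) cos(l x y), for z = x + iy. *)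
Definition saddle_chirp (c l : R) (z : R[i]) : R :=
  expR (c * (complex.Re z ^+ 2 + complex.Im z ^+ 2)) *
  cos (l * (complex.Re z * complex.Im z)).

Lemma measurable_cos_xy (k : R) :
  measurable_fun setT (fun z : R2 => cos (k * (z.1 * z.2)) : R).
Proof.
apply: measurableT_comp; first exact: continuous_measurable_fun (@continuous_cos R).
by apply: measurable_funM => //; exact: measurable_funM.
Qed.

Lemma measurable_saddle_chirp c l : measurable_fun setT (saddle_chirp c l).
Proof.
apply: measurable_fun_complex; rewrite /saddle_chirp/comp/=.
apply: measurable_funM; last exact: measurable_cos_xy.
apply: measurableT_comp => //; apply: measurable_funM => //.
by apply: measurable_funD; exact: measurable_funX.
Qed.

(** Completing the square in both coordinates; p is the net Gaussian rate. *)
Lemma heat_integrand_saddle_chirp (c l t p u v a b : R) : 0 < t ->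
  p = (4 * t)^-1 - c -> 0 < p ->
  let m1 := u / (4 * t * p) in let m2 := v / (4 * t * p) in
  heat_integrand t (saddle_chirp c l) (Complex u v) (Complex a b) =
  expR (p * m1 ^+ 2 + p * m2 ^+ 2 - (u ^+ 2 + v ^+ 2) / (4 * t)) *
  chirp2 p m1 m2 l (a, b).
Proof.
move=> t0 pE p0 m1 m2; rewrite /heat_integrand sqr_normcE /saddle_chirp /chirp2/=.
rewrite [in LHS]mulrAC -expRD !mulrA -!expRD; congr (expR _ * _).
have -> : c = (4 * t)^-1 - p by rewrite pE; ring.
by rewrite /m1 /m2; field; rewrite !gt_eqF.
Qed.

Lemma heat_integrand_integrable (c l t : R) (x : R[i]) : 0 < t -> 4 * t * c < 1 ->
  mu2.-integrable setT
    (fun y => (heat_integrand t (saddle_chirp c l) x (toC y))%:E).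
Proof.
move=> t0 tc; pose p := (4 * t)^-1 - c.
have p0 : 0 < p by rewrite subr_gt0 -[ltRHS]mul1r ltr_pdivlMr; lra.
case: x => u v.
have := @integrable_chirp2 _ p (u / (4 * t * p)) (v / (4 * t * p)) l p0.
move/(integrableZl measurableT (expR (p * (u / (4 * t * p)) ^+ 2 +
  p * (v / (4 * t * p)) ^+ 2 - (u ^+ 2 + v ^+ 2) / (4 * t)))).
apply: eq_integrable => // -[a b] _ /=.
by rewrite (heat_integrand_saddle_chirp _ _ _ _ _ t0 (erefl p) p0).
Qed.

Lemma measurable_heat_integrand (c l t : R) (x : R[i]) :
  measurable_fun setT (heat_integrand t (saddle_chirp c l) x).
Proof.
apply: measurable_funM; first exact: measurable_saddle_chirp.
apply: measurableT_comp => //; apply: measurableT_comp => //.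
apply: measurable_funM => //; apply: measurable_fun_complex; case: x => u v.
rewrite [X in measurable_fun _ X](_ : _ = fun z : R2 =>
  (u - z.1) ^+ 2 + (v - z.2) ^+ 2); last by apply/funext => z; rewrite /comp sqr_normcE.
by apply: measurable_funD; apply: measurable_funX; exact: measurable_funB.
Qed.

Lemma heat_defined_saddle_chirp (c l t : R) : 0 < t -> 4 * t * c < 1 ->
  heat_defined t (saddle_chirp c l).
Proof.
move=> t0 tc x; apply: integrable_dA; last exact: heat_integrand_integrable.
by apply/measurable_EFinP; exact: measurable_heat_integrand.
Qed.

(** With w = c + i l/2, one has p = 1/(4 t) - c and D = |1/(4 t) - w|^2. *)
Lemma heat_saddle_chirp (c l t p D : R) (z : R[i]) : 0 < t ->
  p = (4 * t)^-1 - c -> 0 < p -> D = p ^+ 2 + l ^+ 2 / 4 ->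
  heat t (saddle_chirp c l) z =
  (4 * pi * t)^-1 * (Num.sqrt (pi / p) * Num.sqrt (pi * p / D)) *
  expR ((p - 4 * t * D) / (16 * t ^+ 2 * D) *
        (complex.Re z ^+ 2 + complex.Im z ^+ 2)) *
  cos (l / (16 * t ^+ 2 * D) * (complex.Re z * complex.Im z)).
Proof.
move=> t0 pE p0 DE; case: z => u v.
have D0 : 0 < D by rewrite DE ltr_pwDl ?exprn_gt0// divr_ge0 ?sqr_ge0.
have tc : 4 * t * c < 1.
  have : 0 < 4 * t * p by rewrite !mulr_gt0.
  by rewrite pE mulrBr divff ?gt_eqF ?mulr_gt0//; lra.
rewrite /heat -!mulrA; congr (_ * _).
have -> : \int[dA]_y heat_integrand t (saddle_chirp c l) (u +i* v)%C y =
   \int[mu2]_y heat_integrand t (saddle_chirp c l) (u +i* v)%C (toC y).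
  rewrite /Rintegral integral_dA//; last exact: heat_integrand_integrable.
  by apply/measurable_EFinP; exact: measurable_heat_integrand.
under eq_Rintegral => y _.
  rewrite (_ : toC y = (y.1 +i* y.2)%C)//.
  rewrite (heat_integrand_saddle_chirp _ _ _ _ _ t0 pE p0) -surjective_pairing.
  over.
rewrite RintegralZl//; last exact: integrable_chirp2.
rewrite (@Rintegral_chirp2 _ _ _ _ _ (D / p) (u * p / (4 * t * D))) => //.
- rewrite mulrCA -!mulrA; congr (_ * _).
  have -> : pi / (D / p) = pi * (p / D) by field; rewrite !gt_eqF.
  congr (_ * _); rewrite mulrA -expRD; congr (expR _ * cos _) => /=.
    have l2 : l ^+ 2 = 4 * (D - p ^+ 2) by rewrite DE; field.
    have gen X Y : l * (v * (X * (l * (v * Y)))) =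
        4 * (D - p ^+ 2) * (v * (X * (v * Y))) by rewrite -l2; ring.
    by rewrite gen; field; rewrite !gt_eqF.
  by field; rewrite !gt_eqF.
- by rewrite DE; field; rewrite gt_eqF.
- by field; rewrite !gt_eqF.
Qed.

End complex_plane.

(** * Square integrability against the Gaussian measure *)

Section density.
Context d (T : measurableType d) (R : realType).
Variables (mu nu : {measure set T -> \bar R}) (rho : T -> R).
Hypothesis rho_ge0 : forall x, 0 <= rho x.
Hypothesis mrho : measurable_fun setT rho.
Hypothesis nuE : forall A, measurable A -> nu A = (\int[mu]_(x in A) (rho x)%:E)%E.
Import HBNNSimple.

(** Integration against a measure with density rho, by approximation from below
    with simple functions. *)
Lemma ge0_integral_density (f : T -> \bar R) : measurable_fun setT f ->
  (forall x, 0 <= f x)%E ->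
  (\int[nu]_x f x = \int[mu]_x (f x * (rho x)%:E))%E.
Proof.
move=> mf f0; pose h := nnsfun_approx measurableT mf.
have hf x : (h n x)%:E @[n --> \oo] --> f x.
  exact: (cvg_nnsfun_approx measurableT mf (fun x _ => f0 x)).
have ndh x : {homo (fun n => (h n x)%:E) : a b / (a <= b)%N >-> (a <= b)%E}.
  by move=> a b ab; rewrite lee_fin; exact/lefP/nd_nnsfun_approx.
have mh n : measurable_fun setT (fun x => (h n x)%:E).
  by apply/measurable_EFinP.
have mrho' : measurable_fun setT (fun x => (rho x)%:E).
  exact/measurable_EFinP.
have -> : (\int[nu]_x f x = limn (fun n => \int[nu]_x (h n x)%:E))%E.
  rewrite -monotone_convergence//.
  - by apply: eq_integral => x _; apply/esym/cvg_lim => //; exact: hf.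
  - by move=> n x _; rewrite lee_fin.
have -> : (\int[mu]_x (f x * (rho x)%:E) =
    limn (fun n => \int[mu]_x ((h n x)%:E * (rho x)%:E)))%E.
  rewrite -monotone_convergence//.
  - apply: eq_integral => x _; apply/esym/cvg_lim => //.
    by apply: cvgeZr => //; exact: hf.
  - by move=> n; exact: emeasurable_funM.
  - by move=> n x _; rewrite mule_ge0// lee_fin.
  - by move=> x _ a b ab; rewrite lee_wpmul2r ?lee_fin//; exact/lefP/nd_nnsfun_approx.
congr (limn _); apply/funext => n.
rewrite integralT_nnsfun sintegralE.
have hE x : ((h n x)%:E * (rho x)%:E =
    \sum_(r \in range (h n)) (r * \1_(h n @^-1` [set r]) x)%:E * (rho x)%:E)%E.
  by rewrite -ge0_mule_fsuml => [|r]; [rewrite fsumEFin// -fimfunE|exact: nnfun_muleindic_ge0].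
under [in RHS]eq_integral do rewrite hE.
rewrite ge0_integral_fsum//.
- apply: eq_fsbigr => r; rewrite inE => -[x _ <-].
  set A := _ @^-1` _.
  have mA : measurable A.
    rewrite -[A]setTI; have mhn : measurable_fun setT (h n) by [].
    by apply: mhn => //; exact: measurable_set1.
  rewrite nuE// -ge0_integralZl//.
  + rewrite integral_mkcond; apply: eq_integral => y _.
    rewrite patchE indicE; case: ifPn => _; first by rewrite mulr1.
    by rewrite mulr0 mul0e.
  + exact: measurable_funTS.
  + by move=> y _; rewrite lee_fin.
  + by rewrite lee_fin.
- by move=> r; apply: emeasurable_funM => //; apply/measurable_EFinP; exact: measurable_funM.
- by move=> r x _; rewrite mule_ge0 ?lee_fin// -lee_fin; exact: nnfun_muleindic_ge0.
Qed.
End density.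

Section square_integrability.
Variable R : realType.
Local Notation mu := (@lebesgue_measure R).
Local Notation mu2 := (mu \x mu)%E.
Local Notation R2 := (measurableTypeR R * measurableTypeR R)%type.
Local Notation normc := ComplexField.Normc.normc.

(** In real coordinates the coherent state has modulus e and phase y a1 - x a2. *)
Lemma mul_coherentE (r a1 a2 x y : R) :
  real_complex R r * coherent (Complex a1 a2) (Complex x y) =
  let e := expR (x * a1 + y * a2 - (a1 ^+ 2 + a2 ^+ 2) / 2) in
  Complex (r * (e * cos (y * a1 - x * a2))) (r * (e * sin (y * a1 - x * a2))).
Proof.
rewrite /coherent sqr_normcE/= /cexp /real_complex_def/=.
have -> : x * a1 - y * - a2 - (a1 ^+ 2 + a2 ^+ 2) / 2 =
  x * a1 + y * a2 - (a1 ^+ 2 + a2 ^+ 2) / 2 by ring.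
have -> : x * - a2 + y * a1 + - 0 = y * a1 - x * a2 by ring.
by apply/eqP; rewrite eq_complex/=; apply/andP; split; apply/eqP; ring.
Qed.

Lemma normc_mul_coherent (r : R) (a z : R[i]) :
  normc (real_complex R r * coherent a z) ^+ 2 =
  r ^+ 2 * expR (2 * (complex.Re z * complex.Re a + complex.Im z * complex.Im a)
                 - normc a ^+ 2).
Proof.
case: a z => [a1 a2] [x y]; rewrite mul_coherentE !sqr_normcE/=.
set w := _ + _ - _ / 2; set th := _ - _.
have -> : expR (2 * (x * a1 + y * a2) - (a1 ^+ 2 + a2 ^+ 2)) = expR w ^+ 2.
  by rewrite -expRM_natl; congr expR; rewrite /w; field.
have := cos2Dsin2 th => cs.
transitivity (r ^+ 2 * expR w ^+ 2 * (cos th ^+ 2 + sin th ^+ 2)); first by ring.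
by rewrite cs mulr1.
Qed.

Lemma measurable_mul_coherent (g : R[i] -> R) (a : R[i]) :
  measurable_fun setT g ->
  measurable_fun setT (fun z => real_complex R (g z) * coherent a z).
Proof.
move=> mg; case: a => a1 a2.
have mgC : measurable_fun setT (fun z : R2 => g (toC z)).
  by apply: measurableT_comp => //; exact: measurable_toC.
have mE : measurable_fun setT (fun z : R2 =>
    expR (z.1 * a1 + z.2 * a2 - (a1 ^+ 2 + a2 ^+ 2) / 2) : R).
  apply: measurableT_comp => //; apply: measurable_funD => //.
  by apply: measurable_funD; exact: measurable_funM.
have mth : measurable_fun setT (fun z : R2 => z.2 * a1 - z.1 * a2 : R).
  by apply: measurable_funB; exact: measurable_funM.
apply: measurable_fun_to_complex.
- under eq_fun do rewrite /toC mul_coherentE/=.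
  apply: measurable_funM => //; apply: measurable_funM => //.
  apply: measurableT_comp mth; exact: continuous_measurable_fun (@continuous_cos R).
- under eq_fun do rewrite /toC mul_coherentE/=.
  apply: measurable_funM => //; apply: measurable_funM => //.
  apply: measurableT_comp mth; exact: continuous_measurable_fun (@continuous_sin R).
Qed.

Lemma L2_saddle_chirp_coherent (c l : R) (a : R[i]) : c < 2^-1 ->
  L2 (fun z => real_complex R (saddle_chirp c l z) * coherent a z).
Proof.
move=> c2; have mf := measurable_mul_coherent a (measurable_saddle_chirp c l).
split => //; rewrite /finite_norm unlock; apply: poweR_lty.
pose f z := real_complex R (saddle_chirp c l z) * coherent a z.
rewrite (eq_integral (fun z => (normc (f z) ^+ 2)%:E)); last first.
  by move=> z _; rewrite /= powR_mulrn ?normr_ge0// real_normK// num_real.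
have fE z : normc (f z) ^+ 2 = saddle_chirp c l z ^+ 2 *
    expR (2 * (complex.Re z * complex.Re a + complex.Im z * complex.Im a)
          - normc a ^+ 2) by rewrite normc_mul_coherent.
have mF : measurable_fun setT (fun z => normc (f z) ^+ 2).
  under eq_fun do rewrite fE.
  apply: measurable_funM; first by apply: measurable_funX; exact: measurable_saddle_chirp.
  apply: measurable_fun_complex; rewrite /comp/=; apply: measurableT_comp => //.
  apply: measurable_funD => //; apply: measurable_funM => //.
  by apply: measurable_funD; exact: measurable_funM.
have mFE : measurable_fun setT (fun z => (normc (f z) ^+ 2)%:E).
  exact/measurable_EFinP.
rewrite (ge0_integral_density (@gauss_density_ge0 R) (@measurable_gauss_density R)
  (mu := dA))//; last by move=> z; rewrite lee_fin sqr_ge0.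
have mG : measurable_fun setT (fun z => normc (f z) ^+ 2 * gauss_density z).
  by apply: measurable_funM => //; exact: measurable_gauss_density.
rewrite ge0_integral_dA; last first.
- by move=> z; exact: mulr_ge0 (sqr_ge0 _) (gauss_density_ge0 _).
- exact/measurable_EFinP.
pose p := 1 - 2 * c; have p0 : 0 < p by rewrite /p; lra.
pose K := pi^-1 * expR ((complex.Re a ^+ 2 + complex.Im a ^+ 2) / p - normc a ^+ 2).
have /integrableP[_] : mu2.-integrable setT
    (EFin \o (fun z : R2 => normc (f (toC z)) ^+ 2 * gauss_density (toC z))).
  apply: (@gauss2_dominated_integrable _ p (complex.Re a / p) (complex.Im a / p) K)
    => // -[x y].
  rewrite ger0_norm; last exact: mulr_ge0 (sqr_ge0 _) (gauss_density_ge0 _).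
  rewrite fE /saddle_chirp.
  rewrite /gauss_density (sqr_normcE (toC (x, y))) /toC/= /K.
  set N := normc a ^+ 2.
  have -> : pi^-1 * expR ((complex.Re a ^+ 2 + complex.Im a ^+ 2) / p - N) *
      (expR (- (p * (x - complex.Re a / p) ^+ 2)) *
       expR (- (p * (y - complex.Im a / p) ^+ 2))) =
     pi^-1 * (expR (2 * (c * (x ^+ 2 + y ^+ 2))) *
       expR (2 * (x * complex.Re a + y * complex.Im a) - N) *
       expR (- (x ^+ 2 + y ^+ 2))).
    rewrite -!mulrA -!expRD; congr (_ * expR _).
    have -> : c = (1 - p) / 2 by rewrite /p; field.
    by field; rewrite gt_eqF.
  rewrite expRM_natl [leLHS]mulrCA ler_pM2l ?invr_gt0 ?pi_gt0//.
  rewrite ler_pM2r ?expR_gt0// ler_pM2r ?expR_gt0// exprMn.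
  rewrite ler_piMr ?sqr_ge0//.
apply: le_lt_trans; rewrite le_eqVlt; apply/orP; left; apply/eqP.
apply: eq_integral => z _; rewrite /= ger0_norm//.
exact: mulr_ge0 (sqr_ge0 _) (gauss_density_ge0 _).
Qed.

End square_integrability.

(** * Essential bounds and the counterexample *)

Section essential_bounds.
Variable R : realType.
Local Notation mu := (@lebesgue_measure R).
Local Notation mu2 := (mu \x mu)%E.
Local Notation R2 := (measurableTypeR R * measurableTypeR R)%type.
Implicit Types (A k th : R) (h : R[i] -> R).

Lemma dA_rect (a b c d : R) : a < b -> c < d ->
  (0 < dA [set z : R[i] | (a <= complex.Re z <= b)%R /\ (c <= complex.Im z <= d)%R])%E.
Proof.
move=> ab cd; set B := [set z | _].
have -> : dA B = mu2 (`[a, b]%classic `*` `[c, d]%classic).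
  by congr mu2; apply/funext => -[x y]; rewrite /B /toC /= !in_itv/=.
rewrite product_measure1E//= !lebesgue_measure_itv/= !lte_fin ab cd.
by rewrite -!EFinD -EFinM lte_fin mulr_gt0// subr_gt0.
Qed.

(** On the rectangle [N, N + 1] x [0, d] with d small, the phase th x y is so small that
    the cosine exceeds 1/2, while the Gaussian factor is at least 1 + k N. *)
Lemma growing_chirp_large (h : R[i] -> R) A k th M : 0 < A -> 0 < k ->
  (forall z, h z = A * expR (k * (complex.Re z ^+ 2 + complex.Im z ^+ 2)) *
                   cos (th * (complex.Re z * complex.Im z))) ->
  exists B, [/\ measurable B, (0 < dA B)%E & forall z, B z -> M < `|h z|].
Proof.
move=> A0 k0 hE.
have [e /= e0 cos_e] : exists2 e : R, 0 < e & forall s, `|s| < e -> 2^-1 < cos s.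
  have : \forall s \near (0 : R), 2^-1 < cos s.
    apply: (cvgr_gt (cos 0) (@continuous_cos R 0)); rewrite cos0; lra.
  case=> e /= e0 He; exists e => // s se; apply: He => /=.
  by rewrite sub0r normrN.
(* N is such that A k N / 2 exceeds |M|, and d keeps |th x y| below e. *)
pose N := 1 + 2 * `|M| / (A * k).
have Ak : 0 < A * k by exact: mulr_gt0.
have N1 : 1 <= N by rewrite lerDl; apply: divr_ge0; [exact: mulr_ge0|exact: ltW].
pose d := e / (`|th| * (N + 1) + 1).
have den : 0 < `|th| * (N + 1) + 1.
  by rewrite ltr_pwDr// mulr_ge0//; lra.
have d0 : 0 < d by exact: divr_gt0.
exists [set z | N <= complex.Re z <= N + 1 /\ 0 <= complex.Im z <= d]; split.
- rewrite /measurable/= /complex_measurable/=.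
  rewrite (_ : _ @^-1` _ = `[N, N + 1]%classic `*` `[0, d]%classic).
    by apply: measurableX; exact: measurable_itv.
  by apply/funext => -[x y]; rewrite /toC/= !in_itv/=.
- by apply: dA_rect => //; rewrite ltrDl.
move=> [x y] /= [/andP[Nx xN] /andP[y0 yd]]; rewrite hE/=.
have cs : 2^-1 < cos (th * (x * y)).
  apply: cos_e; rewrite normrM (ger0_norm (_ : 0 <= x * y)); last by rewrite mulr_ge0//; lra.
  apply: (@le_lt_trans _ _ (`|th| * ((N + 1) * d))).
    by rewrite ler_wpM2l// ler_pM//; lra.
  by rewrite /d !mulrA ltr_pdivrMr// mulrC ltr_pM2l// ltrDl.
have e1 : k * N + 1 <= expR (k * (x ^+ 2 + y ^+ 2)).
  rewrite addrC; apply: le_trans (expR_ge1Dx _).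
  rewrite lerD2l ler_pM2l//; have := sqr_ge0 y; nra.
have AN : A * (k * N) = A * k + 2 * `|M|.
  by rewrite /N; field; rewrite !gt_eqF.
rewrite ger0_norm; last by rewrite !mulr_ge0 ?expR_ge0 ?ltW//; lra.
apply: (@lt_le_trans _ _ (A * (k * N + 1) * 2^-1)).
  by rewrite mulrDr AN; have := ler_norm M; lra.
by rewrite ler_pM// ?ler_pM2l ?mulr_ge0//; nra.
Qed.

Lemma ae_le_positive_measure h M B : measurable B -> (0 < dA B)%E ->
  (forall z, B z -> M < `|h z|) -> ~ (\forall z \ae dA, (`|(h z)%:E| <= M%:E)%E).
Proof.
move=> mB B0 hB [N [mN N0 subN]].
have BN : B `<=` N.
  by move=> z /hB Mz; apply: subN => /=; rewrite lee_fin leNgt Mz.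
have : (dA B <= dA N)%E by apply: le_measure => //; rewrite inE.
by rewrite N0 leNgt B0.
Qed.

Lemma Lfun_infty_of_bounded (h : R[i] -> R) M : measurable_fun setT h ->
  (forall z, `|h z| <= M) -> h \in Lfun dA +oo%E.
Proof.
move=> mh hM; rewrite inE; apply/andP; split; rewrite inE//=.
rewrite /finite_norm unlock /Lnorm; case: ifPn => // _.
apply: (@le_lt_trans _ _ M%:E); last exact: ltry.
by apply/ess_supP; apply: nearW => z /=; rewrite lee_fin.
Qed.

Lemma notin_Lfun_infty (h : R[i] -> R) :
  (forall M, exists B, [/\ measurable B, (0 < dA B)%E & forall z, B z -> M < `|h z|]) ->
  h \notin Lfun dA +oo%E.
Proof.
move=> hB; apply/negP; rewrite inE => /andP[_]; rewrite inE/=.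
rewrite /finite_norm unlock /Lnorm.
have -> : (0 < dA [set: R[i]])%E.
  have [B [mB B0 _]] := hB 0; apply: (lt_le_trans B0).
  by apply: le_measure; rewrite ?inE.
case E : (ess_sup _ _) => [M| |]// _.
  have [B [mB B0 hM]] := hB M.
  apply: (ae_le_positive_measure mB B0 hM).
  by have /ess_supP : (ess_sup dA (abse \o (EFin \o h)) <= M%:E)%E by rewrite E.
have [B [mB B0 hM]] := hB 0.
apply: (ae_le_positive_measure mB B0 hM).
by have /ess_supP : (ess_sup dA (abse \o (EFin \o h)) <= 0%:E)%E by rewrite E leNye.
Qed.

(** The counterexample, with boundedness at t0 at every point and unboundedness at t1
    on sets of positive measure. *)
Lemma saddle_chirp_counterexample (t1 t0 : R) : 0 < t1 -> t1 < t0 ->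
  exists g : R[i] -> R,
  [/\ measurable_fun setT g,
      heat_defined t0 g /\ heat_defined t1 g,
      forall a : R[i], L2 (fun z => real_complex R (g z) * coherent a z),
      measurable_fun setT (heat t0 g) /\ exists M, forall z, `|heat t0 g z| <= M &
      forall M, exists B,
        [/\ measurable B, (0 < dA B)%E & forall z, B z -> M < `|heat t1 g z|]].
Proof.
move=> t1_gt0 t10; have t0_gt0 : 0 < t0 by lra.
(* This c is below both 1/2 and 1/(4 t0). *)
pose c := (8 * (t0 + 1))^-1.
have c0 : 0 < c by rewrite invr_gt0; lra.
have cE : c * (8 * (t0 + 1)) = 1 by rewrite mulVf//; lra.
have tc0 : 4 * t0 * c < 1 by nra.
have tc1 : 4 * t1 * c < 1 by nra.
have c2 : c < 2^-1 by nra.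
have s0 : 0 <= c / (4 * t0) - c ^+ 2.
  have -> : c / (4 * t0) - c ^+ 2 = c * (1 - 4 * t0 * c) / (4 * t0) by field; lra.
  by rewrite divr_ge0 ?mulr_ge0//; lra.
(* The choice of l makes c^2 + l^2/4 equal to c/(4 t0). *)
pose l := 2 * Num.sqrt (c / (4 * t0) - c ^+ 2).
have lE : l ^+ 2 / 4 = c / (4 * t0) - c ^+ 2.
  by rewrite /l exprMn sqr_sqrtr//; field; lra.
have p_gt0 t : 0 < t -> 4 * t * c < 1 -> 0 < (4 * t)^-1 - c.
  by move=> t_gt0 tc; rewrite subr_gt0 -[ltRHS]mul1r ltr_pdivlMr; lra.
have heatE t z := fun t_gt0 tc => @heat_saddle_chirp R c l t _ _ z
  t_gt0 erefl (p_gt0 t t_gt0 tc) erefl.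
(* The growth exponent has the sign of 1 - t/t0. *)
have kE t : 0 < t -> (4 * t)^-1 - c - 4 * t * (((4 * t)^-1 - c) ^+ 2 + l ^+ 2 / 4) =
    c * (1 - t / t0).
  by move=> t_gt0; rewrite lE; field; rewrite !gt_eqF.
exists (saddle_chirp c l); split.
- exact: measurable_saddle_chirp.
- by split; exact: heat_defined_saddle_chirp.
- by move=> a; exact: L2_saddle_chirp_coherent.
- have [C [th h0]] : exists C th, forall z,
      heat t0 (saddle_chirp c l) z = C * cos (th * (complex.Re z * complex.Im z)).
    eexists; eexists => z; rewrite (heatE t0)// kE// divff ?gt_eqF// subrr.
    by rewrite mulr0 mul0r mul0r expR0 mulr1.
  split.
    rewrite (funext h0); apply: measurable_funM => //.
    by apply: measurable_fun_complex; exact: measurable_cos_xy.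
  exists `|C| => z; rewrite h0 normrM.
  by rewrite ler_piMr//; exact: norm_cos_le1.
move=> M; have h1 z := heatE t1 z t1_gt0 tc1.
have p1 := p_gt0 t1 t1_gt0 tc1.
have D1 : 0 < ((4 * t1)^-1 - c) ^+ 2 + l ^+ 2 / 4.
  by rewrite ltr_pwDl ?exprn_gt0// divr_ge0 ?sqr_ge0.
apply: (growing_chirp_large M _ _ h1).
- by rewrite !mulr_gt0 ?invr_gt0 ?mulr_gt0 ?sqrtr_gt0 ?divr_gt0 ?mulr_gt0 ?pi_gt0.
- rewrite kE// divr_gt0 ?mulr_gt0 ?exprn_gt0// subr_gt0.
  by rewrite ltr_pdivrMr// mul1r.
Qed.

End essential_bounds.

Theorem theorem4p1 (R : realType) :
  (forall t1 t0 : R, 0 < t1 -> t1 < t0 ->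
     exists g : R[i] -> R,
       [/\ measurable_fun setT g,
           heat_defined t0 g /\ heat_defined t1 g,
           forall a : R[i], L2 (fun z => real_complex R (g z) * coherent a z),
           heat t0 g \in Lfun dA +oo%E &
           heat t1 g \notin Lfun dA +oo%E])
  /\
  (forall e : R, 0 < e -> e < 8^-1 ->
     ~ (forall g : R[i] -> R,
          measurable_fun setT g ->
          (forall a : R[i], L2 (fun z => real_complex R (g z) * coherent a z)) ->
          bounded_fun (heat 8^-1 g) ->
          bounded_fun (heat (8^-1 - e) g))).
Proof.
split=> [t1 t0 t1_gt0 t10|e e0 e8 bdd].
  have [g [mg dg L2g [mh [M hM]] large]] := saddle_chirp_counterexample t1_gt0 t10.
  exists g; split => //; first exact: Lfun_infty_of_bounded hM.
  exact: notin_Lfun_infty.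
have e1 : 0 < 8^-1 - e by lra.
have e2 : 8^-1 - e < 8^-1 by lra.
have [g [mg _ L2g [_ [M hM]] large]] := saddle_chirp_counterexample e1 e2.
have [|M1 [_ bM1]] := bdd g mg L2g.
  exists M; split => [|x Mx z _]; first exact: num_real.
  exact: le_trans (hM z) (ltW Mx).
have hM' z : `|heat (8^-1 - e) g z| <= M1 + 1 by apply: bM1 => //; rewrite ltrDl.
have [B [mB B0 hB]] := large (M1 + 1).
have [B00|/set0P[z Bz]] := eqVneq B set0; first by rewrite B00 measure0 ltxx in B0.
by have := hB z Bz; rewrite ltNge hM'.
Qed.
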